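(* Let $m\ge 1$ and $0<\theta<1$. Then, as $x\to\infty$, \[\sum_{\substack{x^\theta<p\le x\\ p\text{ prime}}}\frac{1}{p\,\lambda_{p,m}} \ll \frac{1}{x^{\theta-1/(m+1)}\log x}.\]
   Context: For a prime $p$ not among the first $m$ primes, $\lambda_{p,m}=\mathrm{lcm}\{\mathrm{ord}_p(a): a \text{ one of the first } m \text{ primes}\}$, where $\mathrm{ord}_p(a)$ is the multiplicative order of $a$ modulo $p$. *)

(* Defs.v *)
From HB Require Import structures.
From mathcomp Require Import all_boot all_order all_algebra all_fingroup.
Set Implicit Arguments.
Unset Strict Implicit.
Unset Printing Implicit Defensive.

Lemma exists_prime_gt (n : nat) : exists p, (n < p)%N && prime p.
Proof. by have [p n_lt_p p_pr] := prime_above n; exists p; rewrite n_lt_p. Qed.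

Definition next_prime (n : nat) : nat := ex_minn (exists_prime_gt n).

Definition first_primes (m : nat) : seq nat := traject next_prime 2 m.

(* Meaningful for 1 < n and a coprime to n; otherwise [insubd] returns the unit 1,
   whose order is 1. *)
Definition ordmod (n a : nat) : nat :=
  #[insubd (1%g : {unit 'Z_n}) (a%:R)%R]%g.

Definition lambda (p m : nat) : nat :=
  \big[lcmn/1%N]_(a <- first_primes m) ordmod p a.

(* Main.v *)
Require Import Defs.
From HB Require Import structures.
From mathcomp Require Import all_boot all_order all_algebra all_fingroup.
From mathcomp Require Import all_classical all_reals all_analysis.
From mathcomp Require Import zify ring.
Import Order.TTheory GRing.Theory Num.Theory.
Import numFieldNormedType.Exports.

(** Since the group of units modulo [p] is cyclic, [lambda p m] bounds the number of
    residues of monomials in the first [m] primes.  If [lambda p m < T ^ m], two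
    monomials with exponents below [T] coincide modulo [p], so [p] divides one of
    at most [(2 T) ^ m] nonzero integers of logarithm [O(T)]; hence the sum of [ln p]
    over all such primes is [O(T ^ m.+1)].  Summing dyadically over [T = 2 ^ j] up to
    [2 ^ J], the largest power of [2] below [x `^ (1 / m.+1)], and using Chebyshev's
    bound (the product of the primes up to [n] is at most [4 ^ n]) for the primes
    with [2 ^ (J * m) <= lambda p m], one gets that the sum of [ln p / lambda p m]
    over [p <= x] is [O(x `^ (1 / m.+1))].  For [x `^ theta < p] we have
    [1 / p <= ln p / (x `^ theta * (theta * ln x))]. *)

(** * Chebyshev's upper bound for the product of the primes up to [n] *)

Lemma prod_primes_dvdn (s : seq nat) (P : pred nat) (N : nat) :
  uniq s -> {in s, forall p, P p -> prime p && (p %| N)} ->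
  \prod_(p <- s | P p) p %| N.
Proof.
elim: s => [|p s IHs] /=; first by rewrite big_nil dvd1n.
move=> /andP[psN s_uniq] sP; rewrite big_cons.
have {}IHs : \prod_(q <- s | P q) q %| N.
  by apply: IHs => // q qs; apply: sP; rewrite inE qs orbT.
case: ifP => // Pp.
have /andP[p_pr pN] := sP p (mem_head _ _) Pp.
rewrite Gauss_dvd ?pN // prime_coprime // Euclid_dvd_prod //.
rewrite big_has_cond; apply/hasP => -[q qs /andP[Pq]].
have /andP[q_pr _] := sP q (mem_behead (s := p :: s) qs) Pq.
by rewrite dvdn_prime2 // => /eqP pq; rewrite pq qs in psN.
Qed.

Lemma prime_dvd_fact (p n : nat) : prime p -> (p %| n`!) = (p <= n).
Proof.
move=> p_pr; elim: n => [|n IHn]; first by rewrite dvdn1 leqn0; case: p p_pr => [|[]].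
rewrite factS Euclid_dvdM // IHn [RHS]leq_eqVlt ltnS.
case: leqP => lt_np; rewrite ?orbT ?orbF //.
apply/idP/eqP => [/dvdn_leq|->//]; lia.
Qed.

(** The entries [k] and [k.+1] of row [k.*2.+1] are equal, and the whole row sums to [2 * 4 ^ k]. *)
Lemma bin_middle_le (k : nat) : 'C(k.*2.+1, k) <= 4 ^ k.
Proof.
have le_k : k < k.*2.+2 by lia.
have le_k1 : k.+1 < k.*2.+2 by lia.
have : \sum_(i < k.*2.+2) 'C(k.*2.+1, i) = 2 * 4 ^ k.
  have := expnDn 1 1 k.*2.+1; rewrite expnS -mul2n expnM => ->.
  by apply: eq_bigr => i _; rewrite !exp1n !muln1.
rewrite (bigD1 (Ordinal le_k)) //= (bigD1 (Ordinal le_k1)) /=; last first.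
  by rewrite -val_eqE /=; lia.
have -> : 'C(k.*2.+1, k.+1) = 'C(k.*2.+1, k).
  by rewrite -bin_sub; [congr 'C(_, _)|]; lia.
by lia.
Qed.

(** Strong induction: an even [n > 2] adds no prime; for [n = k.*2.+1] the primes up to [k.+1]
    contribute at most [4 ^ k.+1], and the product of the later ones divides ['C(n, k)]. *)
Lemma primorial_le (n : nat) : \prod_(0 <= p < n.+1 | prime p) p <= 4 ^ n.
Proof.
elim/ltn_ind: n => n IHn.
have [n_le2|n_gt2] := leqP n 2.
  by case: n n_le2 {IHn} => [|[|[|]]] // _;
    rewrite !big_mkcond !big_nat_recl // big_geq.
have [n_odd|n_even] := boolP (odd n); last first.
  rewrite big_mkcond big_nat_recr //= -big_mkcond /=.
  have /negbTE -> : ~~ prime n by apply/negP => /even_prime[]; lia.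
  case: n n_gt2 IHn {n_even} => // n _ IHn; rewrite muln1.
  by apply: leq_trans (IHn n _) _; rewrite // leq_exp2l.
have [k n_def] : exists k, n = k.*2.+1 by exists n./2; lia.
have le_k : k.+2 <= n.+1 by lia.
rewrite (big_cat_nat _ le_k) //=.
have -> : 4 ^ n = 4 ^ k.+1 * 4 ^ k by rewrite -expnD; congr (_ ^ _); lia.
apply: leq_mul; first by apply: IHn; lia.
apply: leq_trans (bin_middle_le k); apply: dvdn_leq; first by rewrite bin_gt0; lia.
apply: prod_primes_dvdn; first exact: iota_uniq.
move=> p; rewrite mem_index_iota => p_bd p_pr; rewrite p_pr /=.
have le_kn : k <= k.*2.+1 by lia.
have : p %| (k.*2.+1)`! by rewrite prime_dvd_fact //; lia.
(* A prime above [k.+1] divides neither factorial in the denominator of the binomial. *)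
rewrite -(bin_fact le_kn) !Euclid_dvdM // !prime_dvd_fact //.
by case/or3P => //; lia.
Qed.

(** * Orders modulo [p] and the list of the first primes *)

Lemma expn_ordmod (p a : nat) : prime p -> coprime p a ->
  ((a ^ ordmod p a)%:R = 1 :> 'F_p)%R.
Proof.
move=> p_pr pa; have p_gt1 := prime_gt1 p_pr.
set u := insubd (1%g : {unit 'Z_p}) (a%:R)%R.
(* By coprimality [insubd] yields the class of [a], not its default. *)
have val_u : val u = (a%:R)%R by rewrite val_insubd unitZpE // pa.
have : val (u ^+ #[u])%g = val (1%g : {unit 'Z_p}) by rewrite expg_order.
rewrite FinRing.val_unitX FinRing.val_unit1 val_u -natrX -/(ordmod p a).
(* The identity passes from ['Z_p] to ['F_p] through its residue in [nat]. *)
move/(congr1 val); rewrite /= val_Zp_nat // => /= ad1.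
rewrite -(GRing.natr_mod_pchar (pchar_Fp p_pr)) ad1.
by rewrite modn_small // Zp_cast.
Qed.

Lemma dvdn_lambda (p m a : nat) : a \in first_primes m -> ordmod p a %| lambda p m.
Proof.
rewrite /lambda; elim: (first_primes m) => // b s IHs.
rewrite inE big_cons => /predU1P[->|/IHs as_dvd]; first exact: dvdn_lcml.
exact: dvdn_trans as_dvd (dvdn_lcmr _ _).
Qed.

Lemma lambda_gt0 (p m : nat) : 0 < lambda p m.
Proof.
rewrite /lambda; elim/big_ind: _ => // [x y|a _]; last exact: order_gt0.
by rewrite lcmn_gt0 => -> ->.
Qed.

Lemma next_primeP (n : nat) : (n < next_prime n) && prime (next_prime n).
Proof. by rewrite /next_prime; case: ex_minnP. Qed.

Lemma first_primes_prime (m : nat) : all prime (first_primes m).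
Proof.
rewrite /first_primes; have : prime 2 by [].
elim: m 2 => //= m IHm n n_pr; rewrite n_pr IHm //.
by case/andP: (next_primeP n).
Qed.

Lemma first_primes_uniq (m : nat) : uniq (first_primes m).
Proof.
apply: (sorted_uniq ltn_trans ltnn); rewrite /first_primes.
case: m => //= m; elim: m 2 => //= m IHm n; rewrite IHm andbT.
by case/andP: (next_primeP n).
Qed.

Lemma size_first_primes (m : nat) : size (first_primes m) = m.
Proof. exact: size_traject. Qed.

(** * Pigeonhole bound for the primes with small [lambda] *)

Section SmallOrder.

Variables (m : nat) (a : 'I_m -> nat).
Hypotheses (a_pr : forall i, prime (a i)) (a_inj : injective a).

Let monom (e : 'I_m -> nat) := \prod_i a i ^ e i.

(** Unique factorization: distinct exponent vectors give distinct integers, so the differences of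
    monomials used below are nonzero. *)
Lemma logn_monom (e : 'I_m -> nat) (i : 'I_m) : logn (a i) (monom e) = e i.
Proof.
have pos j : 0 < a j ^ e j by rewrite expn_gt0 prime_gt0.
rewrite /monom (bigD1 i) //= lognM ?prodn_gt0 // pfactorK //.
rewrite [logn _ _](_ : _ = 0) ?addn0 //.
elim/big_rec: _ => [|j x ji IH]; first exact: logn1.
(* The induction does not record that [x] is positive; [x = 0] is harmless since [logn _ 0 = 0]. *)
have [->|x_gt0] := posnP x; first by rewrite muln0 logn0.
rewrite lognM // IH addn0 lognX logn_prime //.
by case: eqP => [/a_inj ij|]; [rewrite ij eqxx in ji | rewrite muln0].
Qed.

(* Pigeonhole: the [T ^ m] monomials with exponents below [T] are roots of
   [X^lam - 1], so two of them, with exponents [e] and [e'], agree modulo [p];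
   multiplying by the monomial with exponents [T - e'] turns this into a relation
   indexed by the differences [e - e'] only, of which there are at most
   [(2 T) ^ m], rather than by pairs. *)
Lemma small_exponent_relation (p lam T : nat) : prime p -> 0 < lam ->
  (forall i, ((a i)%:R ^+ lam = 1 :> 'F_p)%R) -> lam < T ^ m ->
  exists2 g : {ffun 'I_m -> 'I_(2 * T)}, [exists i, g i != T :> nat] &
    ((monom (fun i => g i))%:R = (monom (fun=> T))%:R :> 'F_p)%R.
Proof.
move=> p_pr lam_gt0 a_lam lam_lt.
pose f (e : {ffun 'I_m -> 'I_T}) : 'F_p := (monom (fun i => e i))%:R%R.
have /injectivePn[e [e' e_neq fee']] : ~~ injectiveb f.
  apply: contraL lam_lt => /injectiveP f_inj; rewrite -leqNgt.
  have -> : T ^ m = size (codom f) by rewrite size_codom card_ffun !card_ord.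
  apply: (@max_unity_roots 'F_p) => //; last by rewrite map_inj_uniq ?enum_uniq.
  apply/allP => _ /codomP[e ->]; apply/unity_rootP.
  rewrite /f /monom natr_prod -prodrXl big1 // => i _.
  by rewrite natrX exprAC a_lam expr1n.
(* The shift by [T] keeps [e - e'] in [nat]; the value [T] marks the indices where [e] and [e']
   agree. *)
have g_lt i : e i + (T - e' i) < 2 * T by have := ltn_ord (e i); lia.
exists [ffun i => Ordinal (g_lt i)].
  have [i ei] : exists i, e i != e' i.
    apply/existsP; apply: contraR e_neq => /existsPn ee'.
    by apply/eqP/ffunP => i; apply/eqP; have := ee' i; rewrite negbK.
  by apply/existsP; exists i; rewrite ffunE /=; apply: contra ei => /eqP eT;
    apply/eqP/val_inj; move: (ltn_ord (e' i)) eT => /=; lia.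
have monomD e1 e2 : monom (fun i => e1 i + e2 i) = monom e1 * monom e2.
  by rewrite /monom -big_split; apply: eq_bigr => i _; rewrite expnD.
have -> : monom (fun i => [ffun i => Ordinal (g_lt i)] i)
    = monom (fun i => e i) * monom (fun i => T - e' i).
  by rewrite -monomD; apply: eq_bigr => i _; rewrite ffunE.
have -> : monom (fun=> T) = monom (fun i => e' i) * monom (fun i => T - e' i).
  by rewrite -monomD; apply: eq_bigr => i _; rewrite subnKC // ltnW.
by rewrite !natrM; congr (_ * _)%R.
Qed.

(** Each such [p] divides some nonzero [D g], so the product of these distinct primes divides the
    product of the [D g]: at most [(2 * T) ^ m] factors, each at most [A ^ (2 * T)]. *)
Lemma prod_small_exponent_le (s : seq nat) (P : pred nat) (lam : nat -> nat) (T : nat) :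
  uniq s ->
  {in s, forall p, P p -> [/\ prime p, 0 < lam p < T ^ m
     & forall i, ((a i)%:R ^+ lam p = 1 :> 'F_p)%R]} ->
  \prod_(p <- s | P p) p <= (\prod_i a i) ^ ((2 * T) ^ m.+1).
Proof.
move=> s_uniq sP; set A := \prod_i a i.
have A_gt0 : 0 < A by apply: prodn_gt0 => i; apply: prime_gt0.
have prodnX k : \prod_i a i ^ k = A ^ k.
  exact/esym/(big_morph (expn^~ k) (fun x y => expnMn x y k) (exp1n k)).
have monomT : monom (fun=> T) = A ^ T by apply: prodnX.
(* An absolute difference: one of the two truncated subtractions is always zero. *)
pose D (g : {ffun 'I_m -> 'I_(2 * T)}) :=
    (monom (fun i => g i) - A ^ T) + (A ^ T - monom (fun i => g i)).
pose Q := [pred g : {ffun 'I_m -> 'I_(2 * T)} | [exists i, g i != T :> nat]].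
have D_gt0 g : Q g -> 0 < D g.
  case/existsP => i gi; suff : monom (fun i => g i) != A ^ T by rewrite /D; lia.
  by apply: contra gi => /eqP gT; rewrite -(logn_monom (fun i => g i) i) gT -monomT logn_monom.
have D_le g : D g <= A ^ (2 * T).
  suff : monom (fun i => g i) <= A ^ (2 * T) /\ A ^ T <= A ^ (2 * T) by rewrite /D; lia.
  split; last by rewrite leq_pexp2l //; lia.
  rewrite -prodnX; apply: leq_prod => i _.
  by rewrite leq_pexp2l ?prime_gt0 // ltnW.
apply: (@leq_trans (\prod_(g | Q g) D g)).
  apply: dvdn_leq; first exact: prodn_cond_gt0.
  apply: prod_primes_dvdn => // p ps Pp.
  have [p_pr /andP[lam_gt0 lam_lt] a_lam] := sP p ps Pp.
  have [g Qg] := small_exponent_relation _ _ _ p_pr lam_gt0 a_lam lam_lt.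
  rewrite monomT p_pr /= => eq_g; rewrite (bigD1 g) //=; apply: dvdn_mulr.
  have [le_g|/ltnW le_g] := leqP (monom (fun i => g i)) (A ^ T); rewrite /D.
    rewrite (eqP le_g) add0n (dvdn_pcharf (pchar_Fp p_pr)) natrB // eq_g.
    by rewrite subrr.
  rewrite [X in _ + X](eqP le_g) addn0 (dvdn_pcharf (pchar_Fp p_pr)) natrB //.
  by rewrite eq_g subrr.
apply: (@leq_trans (\prod_(g : {ffun 'I_m -> 'I_(2 * T)} | Q g) A ^ (2 * T))).
  by apply: leq_prod => g _; apply: D_le.
rewrite prod_nat_const -expnM expnS leq_pexp2l // leq_mul2l; apply/orP; right.
by apply: leq_trans (max_card _) _; rewrite card_ffun !card_ord.
Qed.

End SmallOrder.

(** As a common multiple of the orders, [lambda p m] is a valid exponent for every [a i]; excluding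
    the first primes makes each [a i] invertible modulo [p]. *)
Lemma prod_small_lambda_le (m n T : nat) :
  \prod_(0 <= p < n.+1 | [&& prime p, p \notin first_primes m & lambda p m < T ^ m]) p
    <= (\prod_(a <- first_primes m) a) ^ ((2 * T) ^ m.+1).
Proof.
pose a (i : 'I_m) := nth 0 (first_primes m) i.
have a_in i : a i \in first_primes m by rewrite mem_nth ?size_first_primes.
have a_pr i : prime (a i) by apply: (allP (first_primes_prime m)).
have a_inj : injective a.
  move=> i j /eqP; rewrite nth_uniq ?size_first_primes ?first_primes_uniq //.
  by move/eqP/val_inj.
have -> : \prod_(b <- first_primes m) b = \prod_i a i.
  by rewrite (big_nth 0) size_first_primes big_mkord.
apply: (@prod_small_exponent_le _ _ a_pr a_inj _ _ (lambda^~ m)).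
  exact: iota_uniq.
move=> p _ /and3P[p_pr p_notin lt_lam]; split => //; first by rewrite lambda_gt0.
move=> i; have /dvdnP[k ->] := dvdn_lambda p _ _ (a_in i).
rewrite mulnC exprM -natrX expn_ordmod ?expr1n // prime_coprime //.
by rewrite dvdn_prime2 //; apply: contra p_notin => /eqP ->.
Qed.

Local Open Scope ring_scope.

(** * Logarithmic sums weighted by [1 / lambda] *)

Lemma ln_nat_ge0 (R : realType) (n : nat) : 0 <= ln (n%:R : R).
Proof.
(* The case [n = 0] rests on the convention [ln 0 = 0]. *)
by case: n => [|n]; [rewrite ln0 | rewrite ln_ge0 // ler1n].
Qed.

Lemma ln_prod_nat (R : realType) (s : seq nat) (P : pred nat) :
  (forall p, P p -> (0 < p)%N) ->
  ln ((\prod_(p <- s | P p) p)%N%:R : R) = \sum_(p <- s | P p) ln p%:R.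
Proof.
move=> P_gt0; elim: s => [|p s IHs]; first by rewrite !big_nil ln1.
rewrite !big_cons; case: ifP => // Pp.
by rewrite natrM lnM ?IHs // posrE ltr0n; [apply: P_gt0|apply: prodn_cond_gt0].
Qed.

Lemma sum_ln_le (R : realType) (s : seq nat) (P : pred nat) (b k : nat) :
  (forall p, P p -> (0 < p)%N) -> (0 < b)%N ->
  (\prod_(p <- s | P p) p <= b ^ k)%N ->
  \sum_(p <- s | P p) ln p%:R <= k%:R * ln b%:R :> R.
Proof.
move=> P_gt0 b_gt0 le_prod; rewrite -ln_prod_nat // mulr_natl -lnXn ?ltr0n //.
by rewrite -natrX ler_ln ?posrE ?ltr0n ?expn_gt0 ?b_gt0 ?prodn_cond_gt0 // ler_nat.
Qed.

Section LambdaSums.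

Variables (R : realType) (m n : nat).

Let P := [pred p | prime p && (p \notin first_primes m)].
Let A := (\prod_(a <- first_primes m) a)%N.

Let A_gt0 : (0 < A)%N.
Proof.
rewrite /A big_seq prodn_cond_gt0 // => a /(allP (first_primes_prime m)).
exact: prime_gt0.
Qed.

Lemma sum_ln_small_lambda (T : nat) :
  \sum_(0 <= p < n.+1 | P p && (lambda p m < T ^ m)%N) ln p%:R
    <= ((2 * T) ^ m.+1)%N%:R * ln A%:R :> R.
Proof.
apply: sum_ln_le => //; first by move=> p /andP[/andP[/prime_gt0]].
apply: leq_trans (prod_small_lambda_le m n T).
by rewrite leq_eqVlt; apply/orP; left; apply/eqP/eq_bigl => p /=; rewrite andbA.
Qed.

Lemma sum_ln_primes : \sum_(0 <= p < n.+1 | P p) ln p%:R <= n%:R * ln 4 :> R.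
Proof.
apply: (@le_trans _ _ (\sum_(0 <= p < n.+1 | prime p) ln p%:R)); last first.
  by apply: sum_ln_le (primorial_le n) => // p /prime_gt0.
rewrite big_mkcond [leRHS]big_mkcond; apply: ler_sum => p _ /=.
by case: (prime p) => //=; case: ifP => // _; apply: ln_nat_ge0.
Qed.

(** A term with [K <= lambda p m] is at most [ln p / K]; the last sum may then run over all of [Q],
    as its terms are nonnegative. *)
Lemma sum_ln_lambda_split (Q : pred nat) (K : nat) : (0 < K)%N ->
  \sum_(0 <= p < n.+1 | Q p) ln p%:R / (lambda p m)%:R
  <= \sum_(0 <= p < n.+1 | Q p && (lambda p m < K)%N) ln p%:R / (lambda p m)%:R
     + (\sum_(0 <= p < n.+1 | Q p) ln p%:R) / K%:R :> R.
Proof.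
move=> K_gt0; rewrite (bigID (fun p => (lambda p m < K)%N)) /= lerD2l mulr_suml.
rewrite big_mkcond [leRHS]big_mkcond; apply: ler_sum => p _ /=.
have ge0 (k : nat) : 0 <= ln p%:R / k%:R :> R.
  by rewrite divr_ge0 ?ln_nat_ge0.
case: (Q p) => //=; case: ltnP => //= le_K.
by rewrite ler_wpM2l ?ln_nat_ge0 // lef_pV2 ?posrE ?ltr0n ?lambda_gt0 // ler_nat.
Qed.

(** Passing from [J] to [J.+1] costs at most [(4 * 2 ^ J) ^ m.+1 * ln A / 2 ^ (J * m)], which equals
    the bound for [J]; so the bound doubles. *)
Lemma sum_ln_lambda_dyadic (J : nat) :
  \sum_(0 <= p < n.+1 | P p && (lambda p m < 2 ^ (J * m))%N)
     ln p%:R / (lambda p m)%:R <= 4 ^+ m.+1 * ln A%:R * 2 ^+ J :> R.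
Proof.
have lnA_ge0 : 0 <= ln A%:R :> R by apply: ln_nat_ge0.
elim: J => [|J IHJ].
  rewrite big_pred0 ?mulr_ge0 ?exprn_ge0 // => p.
  by rewrite mul0n expn0 ltnS leqn0 eqn0Ngt lambda_gt0 andbF.
apply: le_trans (@sum_ln_lambda_split _ (2 ^ (J * m)) _) _; first by rewrite expn_gt0.
rewrite [X in _ <= _ * X]exprS mulr2n mulrDl mul1r mulrDr; apply: lerD.
  rewrite (eq_bigl (fun p => P p && (lambda p m < 2 ^ (J * m))%N)) // => p.
  rewrite -andbA; congr (_ && _); apply: andb_idl => /leq_trans; apply.
  by rewrite leq_exp2l //; lia.
rewrite ler_pdivrMr ?ltr0n ?expn_gt0 //.
rewrite [in leLHS]expnM; apply: le_trans (sum_ln_small_lambda _) _.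
have -> : (2 * 2 ^ J.+1 = 4 * 2 ^ J)%N by rewrite expnS mulnA.
rewrite [leRHS](_ : _ = ((4 * 2 ^ J) ^ m.+1)%N%:R * ln A%:R) //.
by rewrite expnMn natrM !natrX -exprM mulnS exprD; ring.
Qed.

(** Cut at [2 ^ (J * m)]: above it, Chebyshev gives [n * ln 4 / 2 ^ (J * m)], at most
    [2 ^ (m.+1 + J) * ln 4]. *)
Lemma sum_ln_lambda_le (J : nat) : (n < 2 ^ (m.+1 * J.+1))%N ->
  \sum_(0 <= p < n.+1 | P p) ln p%:R / (lambda p m)%:R
  <= (4 ^+ m.+1 * ln A%:R + 2 ^+ m.+1 * ln 4) * 2 ^+ J :> R.
Proof.
move=> n_lt.
apply: le_trans (@sum_ln_lambda_split _ (2 ^ (J * m)) _) _; first by rewrite expn_gt0.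
rewrite mulrDl lerD ?sum_ln_lambda_dyadic // ler_pdivrMr ?ltr0n ?expn_gt0 //.
apply: le_trans sum_ln_primes _.
rewrite [leRHS](_ : _ = (2 ^ (m.+1 * J.+1))%N%:R * ln 4); last first.
  rewrite (_ : m.+1 * J.+1 = m.+1 + J + J * m)%N; last by lia.
  by rewrite !natrX !exprD; ring.
by rewrite ler_wpM2r ?(ln_nat_ge0 R 4) // ler_nat ltnW.
Qed.
End LambdaSums.

(** * Deduction of the estimate from the logarithmic sum *)

Theorem theorem5 (R : realType) (m : nat) (theta : R)
    (m_ge1 : (1 <= m)%N) (theta_gt0 : 0 < theta) (theta_lt1 : theta < 1) :
  exists2 C : R, 0 < C &
    \forall x \near +oo,
      `| \sum_(0 <= p < (Num.truncn x).+1
                | [&& prime p, x `^ theta < p%:R & p%:R <= x])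
           1 / (p%:R * (lambda p m)%:R) |
      <= C * `| 1 / (x `^ (theta - 1 / (m.+1)%:R) * ln x) |.
Proof.
set A := (\prod_(a <- first_primes m) a)%N.
pose C : R := 4 ^+ m.+1 * ln A%:R + 2 ^+ m.+1 * ln 4.
have C_gt0 : 0 < C.
  rewrite ltr_wpDl ?mulr_ge0 ?exprn_ge0 ?ln_nat_ge0 // mulr_gt0 ?exprn_gt0 //.
  by rewrite ln_gt0 // ltr1n.
exists (C / theta); first by rewrite divr_gt0.
pose M := (\max_(a <- first_primes m) a)%N.
near=> x.
have x_gt1 : 1 < x by near: x; apply: nbhs_pinfty_gt.
have x_gtM : (M%:R : R) `^ theta^-1 <= x by near: x; apply: nbhs_pinfty_ge.
have x_gt0 : 0 < x by apply: lt_trans x_gt1.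
have lnx_gt0 : 0 < ln x by apply: ln_gt0.
have xt_gt0 : 0 < x `^ theta by apply: powR_gt0.
have le_M : M%:R <= x `^ theta.
  rewrite -[leLHS](@powRr1 R) // -(mulVf (lt0r_neq0 theta_gt0)) powRrM.
  by apply: ge0_ler_powR; rewrite ?nnegrE ?powR_ge0 // ltW.
(* [J] is the largest exponent with [2 ^ (m.+1 * J) <= n]: this lower bound on [n] gives [le_J], and
   maximality gives the hypothesis of [sum_ln_lambda_le]. *)
set n := Num.truncn x; set J := trunc_log (2 ^ m.+1) n.
have n_gt0 : (0 < n)%N by rewrite truncn_gt0 ltW.
have gt1_2m : (1 < 2 ^ m.+1)%N by rewrite -{1}(expn0 2) ltn_exp2l.
have /andP[le_n lt_n] := trunc_log_bounds gt1_2m n_gt0.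
have le_J : 2 ^+ J <= x `^ (1 / m.+1%:R).
  have -> : 2 ^+ J = ((2 ^ m.+1) ^ J)%N%:R `^ (1 / m.+1%:R) :> R.
    rewrite -expnM mulnC expnM natrX -[in RHS]powR_mulrn // -powRrM.
    by rewrite div1r mulfV ?powRr1 // natrX.
  apply: ge0_ler_powR; rewrite ?nnegrE ?divr_ge0 ?(ltW x_gt0) //.
  have /andP[le_nx _] := truncn_itv (ltW x_gt0).
  by apply: le_trans le_nx; rewrite ler_nat.
have den_gt0 : 0 < x `^ theta * (theta * ln x) by rewrite !mulr_gt0.
rewrite ger0_norm; last first.
  by apply: sumr_ge0 => p _; rewrite divr_ge0 ?mulr_ge0.
apply: (@le_trans _ _ ((\sum_(0 <= p < n.+1 | prime p && (p \notin first_primes m))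
    ln p%:R / (lambda p m)%:R) / (x `^ theta * (theta * ln x)))).
  rewrite mulr_suml big_mkcond [leRHS]big_mkcond; apply: ler_sum => p _ /=.
  case: ifP => [/and3P[p_pr lt_p _]|_]; last first.
    by case: ifP => // _; rewrite !divr_ge0 ?ln_nat_ge0 ?(ltW den_gt0).
  have p_gt0 : 0 < p%:R :> R by rewrite ltr0n prime_gt0.
  have lam_gt0 : 0 < (lambda p m)%:R :> R by rewrite ltr0n lambda_gt0.
  have -> : p \notin first_primes m.
    apply/negP => p_in; have := le_lt_trans le_M lt_p.
    by rewrite ltr_nat ltnNge leq_bigmax_seq.
  rewrite p_pr /= div1r -mulrA -invfM ler_pdivlMr ?mulr_gt0 //.
  rewrite mulrC ler_pdivrMr ?mulr_gt0 //.
  rewrite [leRHS](_ : _ = p%:R * ln p%:R * (lambda p m)%:R); last by ring.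
  rewrite [leLHS](_ : _ = x `^ theta * ln (x `^ theta) * (lambda p m)%:R); last first.
    by rewrite ln_powR; ring.
  rewrite ler_pM2r //; apply: ler_pM; first exact: powR_ge0.
  - by rewrite ln_powR mulr_ge0 ?ltW.
  - exact: ltW.
  - by rewrite ler_ln ?posrE // ltW.
rewrite ger0_norm; last by rewrite divr_ge0 ?mulr_ge0 ?powR_ge0 ?ltW.
rewrite powRB; last by rewrite (gt_eqF x_gt0) implybT.
rewrite ler_pdivrMr //.
apply: le_trans (@sum_ln_lambda_le R m n J _) _; first by rewrite expnM.
(* After cancellation only [le_J], scaled by [C], is left. *)
rewrite -/A -/C [leRHS](_ : _ = C * x `^ (1 / m.+1%:R)); last first.
  by field; rewrite !gt_eqF ?powR_gt0.
by rewrite ler_pM2l.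
Unshelve. all: by end_near.
Qed.
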